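(* Let $d>0$ be an integer, let $N\geq d$ be an integer, and let $c\geq 0$ and $m>0$ be integers. Then $\operatorname{div}(n,d)=\operatorname{div}(c\cdot n+c,\,m)$ for all integers $n\in[0,N]$ if and only if $$\left(1-\frac{1}{N-\operatorname{rem}(N,d)+1}\right)\frac1d\leq \frac cm<\frac1d.$$
   Context: For a non-negative real $x$ and a positive real $y$, define $\operatorname{div}(x,y)=\lfloor x/y\rfloor$ and $\operatorname{rem}(x,y)=x-\lfloor x/y\rfloor\cdot y$, where $\lfloor\cdot\rfloor$ is the floor function. *)

(* Defs.v *)
From mathcomp Require Import all_boot all_order all_algebra.
From mathcomp Require Import reals.

Set Implicit Arguments.
Unset Strict Implicit.
Unset Printing Implicit Defensive.

Import Order.TTheory GRing.Theory Num.Theory.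
Local Open Scope ring_scope.

(* Meant for [0 <= x] and [0 < y]; total on all reals for convenience. *)
Definition real_div (R : realType) (x y : R) : int := Num.floor (x / y).

Definition real_rem (R : realType) (x y : R) : R :=
  x - (Num.floor (x / y))%:~R * y.

(* Main.v *)
(** Writing [K] for the quotient of [N] by [d], both bounds become integer
    inequalities: [K * m <= c * (K * d + 1)] and [c * d < m].  They are the
    instances [n = K * d] (lower bound on the quotient) and [n = d - 1] (upper
    bound) of the required equality.  Conversely [c * d < m] gives the upper
    bound for every [n], and, since [q * (m - c * d)] is nondecreasing in [q],
    the inequality at [K] gives the lower bound for every quotient [q <= K]. *)
Require Import Defs.
From mathcomp Require Import all_boot all_order all_algebra.
From mathcomp Require Import reals.
From mathcomp Require Import zify ring.

Set Implicit Arguments.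
Unset Strict Implicit.
Unset Printing Implicit Defensive.

Import Order.TTheory GRing.Theory Num.Theory.
Local Open Scope ring_scope.

(** Removes division from quotient equalities, leaving inequalities for [nia] and [lia]. *)
Lemma divz_eqP (a b q : int) : 0 < b ->
  reflect (q = (a %/ b)%Z) (q * b <= a < (q + 1) * b).
Proof.
move=> b_gt0; have := divz_eq a b.
have := modz_ge0 a (lt0r_neq0 b_gt0); have := ltz_pmod a b_gt0.
move: (a %/ b)%Z (a %% b)%Z => k r r_lt r_ge0 ->.
by apply: (iffP andP) => [[]|->]; nia.
Qed.

Lemma real_div_intr (R : realType) (a b : int) : 0 < b ->
  real_div (a%:~R : R) b%:~R = (a %/ b)%Z.
Proof.
move=> b_gt0; have /(divz_eqP _ _ b_gt0)/andP[le_a lt_a] := erefl (a %/ b)%Z.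
apply: floor_def; rewrite ler_pdivlMr ?ltr_pdivrMr ?ltr0z //.
by rewrite -!intrM ler_int ltr_int le_a.
Qed.

(** The remainder enters the bounds only through this difference, the largest multiple of [b] not
    exceeding [a]. *)
Lemma real_rem_intr (R : realType) (a b : int) : 0 < b ->
  (a%:~R : R) - real_rem (a%:~R : R) b%:~R = ((a %/ b)%Z * b)%:~R.
Proof.
by move=> b_gt0; rewrite /real_rem subKr -/(real_div _ _) real_div_intr // intrM.
Qed.

Lemma div_eq_div_mulS (d N c m : int) :
  0 < d -> d <= N -> 0 <= c -> 0 < m ->
  (forall n : int, 0 <= n <= N -> (n %/ d)%Z = ((c * n + c) %/ m)%Z) <->
  (N %/ d)%Z * m <= c * ((N %/ d)%Z * d + 1) /\ c * d < m.
Proof.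
move=> d_gt0 le_dN c_ge0 m_gt0.
have /(divz_eqP _ _ d_gt0)/andP[] := erefl (N %/ d)%Z.
move: (N %/ d)%Z => K leK ltK; have K_gt0 : 0 < K by nia.
split=> [eq_div | [lower upper] n /andP[n_ge0 le_nN]].
  split.
    have eqK : K = (K * d %/ d)%Z by rewrite mulzK ?gt_eqF.
    have : K = ((c * (K * d) + c) %/ m)%Z by rewrite [LHS]eqK; apply: eq_div; nia.
    by move/(divz_eqP _ _ m_gt0); nia.
  (* [d <= N] puts [d - 1] in range; there [c * n + c] is exactly [c * d]. *)
  have eq0 : 0 = ((d - 1) %/ d)%Z by apply/divz_eqP; lia.
  have : 0 = ((c * (d - 1) + c) %/ m)%Z by rewrite [LHS]eq0; apply: eq_div; lia.
  by move/(divz_eqP _ _ m_gt0); nia.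
apply/divz_eqP => //.
have /(divz_eqP _ _ d_gt0)/andP[] := erefl (n %/ d)%Z.
move: (n %/ d)%Z => q le_qn lt_nq.
have le_qK : q <= K by nia.
have q_ge0 : 0 <= q by nia.
(* [lower] says [K * (m - c * d) <= c]; with [mono] and [low] this yields [q * m <= c * n + c]. *)
have mono : q * (m - c * d) <= K * (m - c * d) by rewrite ler_wpM2r //; lia.
have low : c * (q * d) <= c * n by rewrite ler_wpM2l.
(* Integrality turns [n < (q + 1) * d] into [n + 1 <= (q + 1) * d], which absorbs the shift by
   [c]. *)
have up : c * (n + 1) <= c * ((q + 1) * d) by rewrite ler_wpM2l //; lia.
have ltq : (q + 1) * (c * d) < (q + 1) * m by rewrite ltr_pM2l //; lia.
by apply/andP; split; lia.
Qed.

Theorem theorem3 (R : realType) (d N c m : int)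
    (d_gt0 : 0 < d) (le_dN : d <= N) (c_ge0 : 0 <= c) (m_gt0 : 0 < m) :
  (forall n : int, 0 <= n <= N ->
     real_div (n%:~R : R) d%:~R = real_div ((c * n + c)%:~R : R) m%:~R)
  <->
  ((1 : R) - 1 / (N%:~R - real_rem (N%:~R : R) d%:~R + 1)) * (1 / d%:~R)
    <= (c%:~R : R) / m%:~R < 1 / d%:~R.
Proof.
have dR_gt0 : (0 : R) < d%:~R by rewrite ltr0z.
have mR_gt0 : (0 : R) < m%:~R by rewrite ltr0z.
have K_ge0 : 0 <= (N %/ d)%Z by rewrite divz_ge0 //; lia.
have KdR_gt0 : (0 : R) < ((N %/ d)%Z * d + 1)%:~R.
  by rewrite ltr0z ltr_wpDl // mulr_ge0 // ltW.
(* With [K] the quotient, [1 - 1 / (K * d + 1)] is [K * d / (K * d + 1)], and the factor [d]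
   cancels. *)
have lowerE : ((1 : R) - 1 / (N%:~R - real_rem (N%:~R : R) d%:~R + 1))
    * (1 / d%:~R) = (N %/ d)%Z%:~R / ((N %/ d)%Z * d + 1)%:~R.
  rewrite real_rem_intr //; move: KdR_gt0; rewrite intrD intrM => KdR_gt0.
  by field; rewrite !gt_eqF.
have bounds : (((1 : R) - 1 / (N%:~R - real_rem (N%:~R : R) d%:~R + 1))
      * (1 / d%:~R) <= (c%:~R : R) / m%:~R < 1 / d%:~R)
    = ((N %/ d)%Z * m <= c * ((N %/ d)%Z * d + 1)) && (c * d < m).
  rewrite lowerE ler_pdivrMr // mulrAC ler_pdivlMr // -!intrM ler_int.
  by rewrite ltr_pdivrMr // mulrAC ltr_pdivlMr // mul1r -intrM ltr_int.
rewrite bounds -(rwP andP) -div_eq_div_mulS //.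
by split=> eq_div n /eq_div; rewrite !real_div_intr.
Qed.
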